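(* Let $K$ be a field of characteristic zero, let $a_0(x),a_2(x)\in K[x]$, and let $D=y\partial_x+(a_2(x)y^2+a_0(x))\partial_y$, a $K$-derivation of $K[x,y]$. Then $D$ is simple if and only if $a_0(x)\in K^*$ and $\deg a_2(x)\geq 1$.
   Context: $K^*=K\setminus\{0\}$ (viewed inside $K[x]$ as the nonzero constants), $\deg 0=-\infty$, and $\partial_x,\partial_y$ are the partial derivatives on $K[x,y]$. A $K$-derivation $D$ of $K[x,y]$ is a $K$-linear map satisfying $D(ab)=D(a)b+aD(b)$. An ideal $I$ is $D$-stable if $D(I)\subset I$. $D$ is called simple if $K[x,y]$ has no $D$-stable ideals other than $0$ and $K[x,y]$. *)

(* Defs.v *)
From mathcomp Require Import all_boot all_order all_algebra ring.

Set Implicit Arguments.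
Unset Strict Implicit.
Unset Printing Implicit Defensive.

Import GRing.Theory.
Local Open Scope ring_scope.

(* K[x,y] is K[x][y]: the outer variable is y, and x is the variable of the
   coefficients.  Thus a(x) in K[x] embeds as a%:P, a scalar c as c%:P%:P. *)
Notation "{ 'polyxy' K }" := {poly {poly K}}.

Definition varx (K : fieldType) : {polyxy K} := 'X%:P.
Definition vary (K : fieldType) : {polyxy K} := 'X.

Definition partial_x (K : fieldType) (p : {polyxy K}) : {polyxy K} :=
  map_poly (fun a : {poly K} => a^`()) p.
Definition partial_y (K : fieldType) (p : {polyxy K}) : {polyxy K} := p^`().

Definition is_derivation (K : fieldType) (D : {polyxy K} -> {polyxy K}) : Prop :=
  [/\ forall p q, D (p + q) = D p + D q,
      forall (c : K) p, D (c%:P%:P * p) = c%:P%:P * D p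
    & forall p q, D (p * q) = D p * q + p * D q].

(* Ideals are Prop-valued, so that they need not be decidable. *)
Definition is_ideal (R : comNzRingType) (I : R -> Prop) : Prop :=
  [/\ I 0, forall p q, I p -> I q -> I (p + q)
    & forall r p, I p -> I (r * p)].

Definition is_stable (R : comNzRingType) (D : R -> R) (I : R -> Prop) : Prop :=
  forall p, I p -> I (D p).

Definition is_simple (K : fieldType) (D : {polyxy K} -> {polyxy K}) : Prop :=
  is_derivation D /\
  forall I : {polyxy K} -> Prop, is_ideal I -> is_stable D I ->
    (forall p, I p <-> p = 0) \/ (forall p, I p).

Definition riccati (K : fieldType) (a0 a2 : {poly K}) (p : {polyxy K}) :
    {polyxy K} :=
  vary K * partial_x p + (a2%:P * vary K ^+ 2 + a0%:P) * partial_y p.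

Section RiccatiDerivation.
Variable K : fieldType.
Implicit Types (p q : {polyxy K}).

Lemma partial_xE p i : (partial_x p)`_i = (p`_i)^`().
Proof. by rewrite coef_map_id0 // raddf0. Qed.

Lemma partial_xD p q : partial_x (p + q) = partial_x p + partial_x q.
Proof. by apply/polyP=> i; rewrite coefD !partial_xE coefD derivD. Qed.

Lemma partial_xM p q :
  partial_x (p * q) = partial_x p * q + p * partial_x q.
Proof.
apply/polyP=> i; rewrite coefD partial_xE !coefM raddf_sum -big_split /=.
by apply: eq_bigr => j _; rewrite derivM !partial_xE.
Qed.

Lemma partial_xC (a : {poly K}) : partial_x a%:P = a^`()%:P.
Proof. by apply/polyP=> i; rewrite partial_xE !coefC; case: eqP => // _; rewrite raddf0. Qed.

Lemma riccati_derivation (a0 a2 : {poly K}) : is_derivation (riccati a0 a2).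
Proof.
have rM p q : riccati a0 a2 (p * q) =
    riccati a0 a2 p * q + p * riccati a0 a2 q.
  rewrite /riccati partial_xM /partial_y derivM; ring.
split=> // [p q | c p].
  by rewrite /riccati partial_xD /partial_y derivD !mulrDr addrACA.
by rewrite rM /riccati partial_xC /partial_y !derivC !mulr0 addr0 mul0r add0r.
Qed.

Lemma riccati_x (a0 a2 : {poly K}) : riccati a0 a2 (varx K) = vary K.
Proof. by rewrite /riccati partial_xC /partial_y derivC derivX mulr1 mulr0 addr0. Qed.

Lemma riccati_y (a0 a2 : {poly K}) :
  riccati a0 a2 (vary K) = a2%:P * vary K ^+ 2 + a0%:P.
Proof.
rewrite /riccati /partial_y derivX mulr1 (_ : partial_x _ = 0) ?mulr0 ?add0r //.
apply/polyP=> i; rewrite partial_xE coefX coef0.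
by case: (i == 1%N); rewrite ?raddf0 // -polyC1 derivC.
Qed.

End RiccatiDerivation.

(* Main.v *)
Require Import Defs.
From mathcomp Require Import all_boot all_order all_algebra ring zify.
From Stdlib Require Import Classical.

Set Implicit Arguments.
Unset Strict Implicit.
Unset Printing Implicit Defensive.

Import GRing.Theory.
Local Open Scope ring_scope.

(** Write D for the derivation, with D x = y and D y = a2 y^2 + a0.

    If D is simple, two families of stable ideals are excluded.  The ideal
    (a0, y) is stable and nonzero, so it is the whole ring and a0 is a nonzero
    constant c.  If in addition a2 were a constant e, then e y^2 + c (for
    e <> 0) or y^2 - 2 c x (for e = 0) would divide its own image under D, and
    generate a proper nonzero stable ideal.

    Conversely let a0 = c <> 0 and deg a2 >= 1, let I be a nonzero stable ideal
    and F an element of I of least degree d in y among the nonzero ones.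

    If d = 0, then F = p(x).  From p y^n in I one gets p' y^(n+2) in I, so after
    finitely many derivations a power of y lies in I
    ([stable_ideal_polyC]); since D (y^(n+1)) is (n+1) c y^n modulo y^(n+1),
    the exponent goes down to 0 ([stable_ideal_Xn]) and I is the whole ring.

    If d > 0, pseudo-division of D F by F has remainder 0 by minimality of d, so
    u D F = Q F with u in K[x] nonzero.  Gauss's lemma for K[x][y] lets us
    replace F by its primitive part and u by 1 ([riccati_no_darboux]).  Then
    Q = alpha y + beta, and comparing the coefficients of y^(d+1) shows that the
    leading coefficient f_d divides its derivative.  It is therefore constant
    and alpha = d a2.  The other coefficients give, for h_k = f_(d-k),
      h_(k+2)' = (k+2) a2 h_(k+2) + beta h_(k+1) - (d-k) c h_k,
    and because deg a2 >= 1 this forces deg h_k to be nondecreasing in k, with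
    no h_k equal to zero ([riccati_recurrence_neq0]).  This is absurd, since
    h_(d+1) = f_(-1) = 0. *)

(** * Primitive polynomials and Gauss's lemma in K[x][y] *)

Definition primitive (K : fieldType) (F : {polyxy K}) : Prop :=
  forall v : {poly K}, (forall i, v %| F`_i) -> v %| 1.

Lemma polyC_dvd_coef (K : fieldType) (v : {poly K}) (P : {polyxy K}) :
  (forall i, v %| P`_i) <-> exists P', P = v%:P * P'.
Proof.
split=> [vP | [P' -> i]]; last by rewrite coefCM dvdp_mulr.
exists (\poly_(i < size P) (P`_i %/ v)); apply/polyP=> i.
rewrite coefCM coef_poly; case: ltnP => [_ | le_P_i].
  by rewrite mulrC divpK.
by rewrite mulr0 nth_default.
Qed.

(** The content is the gcd of the coefficients: dividing by it leaves no common
    factor, since such a factor could be absorbed into the gcd. *)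
Lemma primitive_part (K : fieldType) (F : {polyxy K}) : F != 0 ->
  exists v F0, [/\ v != 0, F = v%:P * F0 & primitive F0].
Proof.
move=> F_neq0; pose v := foldr (@gcdp K) 0 F.
have vP w : (w %| v) = all (fun a => w %| a) F.
  by rewrite /v; elim: (polyseq F) => [|a s IH] /=; rewrite ?dvdp0 // dvdp_gcd IH.
have dvd_coef w : (w %| v) <-> forall i, w %| F`_i.
  rewrite vP; split=> [wF i | wF]; last by apply/(all_nthP 0) => i _.
  have [ltiF | leFi] := ltnP i (size F); last by rewrite nth_default ?dvdp0.
  exact: (all_nthP 0 wF).
have [F0 defF] := (polyC_dvd_coef v F).1 ((dvd_coef v).1 (dvdpp v)).
have v_neq0 : v != 0.
  by apply: contra_neq F_neq0 => v0; rewrite defF v0 mul0r.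
exists v, F0; split=> // w wF0.
rewrite -(dvdp_mul2l _ _ v_neq0) mulr1; apply/dvd_coef => i.
by rewrite defF coefCM dvdp_mul2l.
Qed.

(** If u is prime to the constant term of Q, then Q is a unit among power series
    in y modulo u: the coefficients of F can be recovered from those of Q F one
    after the other. *)
Lemma dvd_coef_coprime (K : fieldType) (u : {poly K}) (Q F : {polyxy K}) :
  coprimep u Q`_0 -> (forall i, u %| (Q * F)`_i) -> forall i, u %| F`_i.
Proof.
move=> cuQ uQF; elim/ltn_ind=> i IH.
have := uQF i; rewrite coefM big_ord_recl /= subn0 dvdp_addl ?Gauss_dvdpr //.
apply: (big_ind (fun p => u %| p)) => [|p q|j _]; rewrite ?dvdp0 //.
  exact: dvdp_add.
by apply/dvdp_mull/IH; have := ltn_ord j; rewrite /bump /=; lia.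
Qed.

(** Gauss's lemma without irreducible factors.  Put v = gcd(u, b) with b the
    constant term.  Modulo v the polynomial is y times a shorter one, so by
    induction v divides all its coefficients.  After division by v, the constant
    term is prime to u / v, which therefore divides all coefficients of the
    primitive F; hence u / v is a unit and u divides v. *)
Lemma gauss_coef (K : fieldType) (F : {polyxy K}) : primitive F ->
  forall (Q : {polyxy K}) (u : {poly K}), u != 0 ->
  (forall i, u %| (Q * F)`_i) -> forall i, u %| Q`_i.
Proof.
move=> primF; elim/poly_ind=> [u _ _ i | Q b IH u u_neq0 uQF].
  by rewrite coef0 dvdp0.
pose v := gcdp u b.
have v_neq0 : v != 0 by rewrite gcdp_eq0 negb_and u_neq0.
have vQ : forall i, v %| Q`_i.
  apply: IH => // i; have := uQF i.+1.
  rewrite mulrDl -mulrA ['X * F]mulrC mulrA coefD coefMX coefCM /=.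
  move/(dvdp_trans (dvdp_gcdl u b)).
  by rewrite dvdp_addl // dvdp_mulr // dvdp_gcdr.
have vQb : forall i, v %| (Q * 'X + b%:P)`_i.
  move=> i; rewrite coefD coefMX coefC.
  by case: i => [|i] /=; rewrite ?add0r ?addr0 ?dvdp_gcdr.
suff uv : u %| v by move=> i; apply: dvdp_trans uv _.
have [Q' defQ'] := (polyC_dvd_coef v _).1 vQb.
have defu : u = v * (u %/ v).
  by rewrite mulrC divpK // dvdp_gcdl.
have defb : Q'`_0 = b %/ v.
  apply: (mulfI v_neq0); rewrite -coefCM -defQ' [RHS]mulrC divpK ?dvdp_gcdr //.
  by rewrite coefD coefMX coefC add0r.
rewrite {1}defu -[X in _ %| X]mulr1 dvdp_mul2l //; apply: primF.
apply: (dvd_coef_coprime (Q := Q')) => [|i].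
  by rewrite defb coprimep_div_gcd // u_neq0.
by have := uQF i; rewrite defQ' -mulrA coefCM {1}defu dvdp_mul2l.
Qed.

Lemma gauss_primitive (K : fieldType) (F G Q : {polyxy K}) (u : {poly K}) :
  primitive F -> u != 0 -> u%:P * G = Q * F -> exists Q', G = Q' * F.
Proof.
move=> primF u_neq0 eqG.
have [i | Q' defQ] := (polyC_dvd_coef u Q).1.
  apply: (gauss_coef primF u_neq0) => j.
  by rewrite -eqG coefCM dvdp_mulr.
exists Q'; apply: (@mulfI _ u%:P); first by rewrite polyC_eq0.
by rewrite eqG defQ mulrA.
Qed.

(** * Degrees of polynomial solutions of first-order equations *)

Lemma natr_neq0 (K : fieldType) (charK : [pchar K] =i pred0) (n : nat) :
  (0 < n)%N -> n%:R != 0 :> K.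
Proof. by move=> n_gt0; rewrite (pcharf0P K).1 // -lt0n. Qed.

Lemma dvd_deriv_const (K : fieldType) (charK : [pchar K] =i pred0)
    (p : {poly K}) : p %| p^`() -> (size p <= 1)%N.
Proof.
have [-> | p_neq0 dvd_p] := eqVneq p 0; first by rewrite size_poly0.
have p'0 : p^`() = 0.
  apply: contraTeq dvd_p => p'_neq0; apply/negP => /(dvdp_leq p'_neq0).
  by rewrite leqNgt lt_size_deriv.
apply/leq_sizeP => -[|j] // _; apply: (mulIf (natr_neq0 charK (ltn0Sn j))).
by rewrite mulr_natr -coef_deriv p'0 coef0 mul0r.
Qed.

(** In f' - k a f the term k a f dominates, so the degree of the right-hand side
    of the equation determines the degree of a solution. *)
Lemma size_first_order (K : fieldType) (charK : [pchar K] =i pred0)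
    (a f r : {poly K}) (k : nat) :
  (0 < k)%N -> a != 0 -> f != 0 -> f^`() = (a * f) *+ k + r ->
  size r = (size a + size f).-1.
Proof.
move=> k_gt0 a_neq0 f_neq0 eqf.
have -> : r = - (k%:R *: (a * f) - f^`()) by rewrite eqf scaler_nat; ring.
have size_af : size (k%:R *: (a * f)) = (size a + size f).-1.
  by rewrite size_scale ?natr_neq0 // size_mul.
rewrite size_polyN size_polyDl size_af // size_polyN.
apply: leq_trans (lt_size_deriv f_neq0) _.
by rewrite -size_poly_gt0 in a_neq0; lia.
Qed.

(** If b = 0, the first equation forces h_1 = 0, and the second one has no
    solution: its right-hand side is a nonzero constant, whereas a has positive
    degree.  Otherwise the first equation gives deg b = deg a + deg h_1 >= 1.
    By induction b h_(k+1) has larger degree than h_k, so the inhomogeneous term of the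
    equation for h_(k+2) has degree deg b + deg h_(k+1), and
    deg h_(k+2) = deg b - deg a + deg h_(k+1) >= deg h_(k+1). *)
Lemma riccati_recurrence_neq0 (K : fieldType) (charK : [pchar K] =i pred0)
    (a b : {poly K}) (c : K) (d : nat) (h : nat -> {poly K}) :
  (1 < size a)%N -> c != 0 -> (0 < d)%N -> size (h 0%N) = 1%N ->
  (h 1%N)^`() = a * h 1%N + b * h 0%N ->
  (forall k, (k < d)%N ->
     (h k.+2)^`() = (a * h k.+2) *+ k.+2 + (b * h k.+1 - (c *: h k) *+ (d - k))) ->
  h d.+1 != 0.
Proof.
move=> a_gt1 c_neq0 d_gt0 h0_1 eq1 eqS.
have a_neq0 : a != 0 by rewrite -size_poly_gt0; lia.
have h0_neq0 : h 0%N != 0 by rewrite -size_poly_gt0 h0_1.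
have size_ch k : (k < d)%N -> size ((c *: h k) *+ (d - k)) = size (h k).
  by move=> lt_kd; rewrite -scaler_nat !size_scale // natr_neq0 // subn_gt0.
have b_neq0 : b != 0.
  apply/eqP => b0.
  have h1_0 : h 1%N = 0.
    apply/eqP/negPn/negP => h1_neq0.
    have := @size_first_order _ charK a (h 1%N) (b * h 0%N) 1 isT a_neq0 h1_neq0 eq1.
    by rewrite b0 mul0r size_poly0; rewrite -size_poly_gt0 in h1_neq0; lia.
  have := eqS 0 d_gt0; rewrite h1_0 mulr0 add0r => eq2.
  have size_r : size (- ((c *: h 0%N) *+ (d - 0))) = 1%N.
    by rewrite size_polyN size_ch.
  have [h2_0 | h2_neq0] := eqVneq (h 2%N) 0.
    move: eq2; rewrite h2_0 deriv0 mulr0 mul0rn add0r => r0.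
    by move: size_r; rewrite -r0 size_poly0.
  have := size_first_order charK (ltn0Sn 1) a_neq0 h2_neq0 eq2.
  by rewrite size_r; rewrite -size_poly_gt0 in h2_neq0; lia.
have h1_neq0 : h 1%N != 0.
  apply/eqP => h1_0; move/eqP: eq1.
  by rewrite h1_0 deriv0 mulr0 add0r eq_sym mulf_eq0 (negPf b_neq0) (negPf h0_neq0).
have size_b : size b = (size a + size (h 1%N)).-1.
  rewrite -(@size_first_order _ charK a (h 1%N) (b * h 0%N) 1) //.
  by rewrite size_mul // h0_1 addn1.
have h1_gt0 : (0 < size (h 1%N))%N by rewrite size_poly_gt0.
have b_gt1 : (1 < size b)%N by rewrite size_b; lia.
suff grow k : (k <= d)%N -> (0 < size (h k))%N /\ (size (h k) <= size (h k.+1))%N.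
  by rewrite -size_poly_gt0; have [] := grow d (leqnn d); lia.
elim: k => [|k IH] le_kd; first by rewrite h0_1.
have [hk_gt0 hk_le] := IH (ltnW le_kd).
have hSk_gt0 := leq_trans hk_gt0 hk_le; split=> //.
have size_r : size (b * h k.+1 - (c *: h k) *+ (d - k)) = (size b + size (h k.+1)).-1.
  have size_bh : size (b * h k.+1) = (size b + size (h k.+1)).-1.
    by rewrite size_mul // -size_poly_gt0.
  by rewrite size_polyDl size_bh // size_polyN size_ch //; lia.
have := eqS k le_kd.
have [-> | hSSk_neq0 eqk] := eqVneq (h k.+2) 0.
  rewrite deriv0 mulr0 mul0rn add0r => r0.
  by move: size_r; rewrite -r0 size_poly0; lia.
have := size_first_order charK (ltn0Sn k.+1) a_neq0 hSSk_neq0 eqk.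
by rewrite size_r; lia.
Qed.

(** * The derivation on coefficients, products and powers of y *)

Lemma coef_riccati0 (K : fieldType) (a0 a2 : {poly K}) (F : {polyxy K}) :
  (riccati a0 a2 F)`_0 = a0 * F`_1.
Proof.
rewrite /riccati /vary /partial_y mulrDl -mulrA !coefD coefXM !coefCM coefXnM.
by rewrite /= mulr0 !add0r coef_deriv.
Qed.

Lemma coef_riccatiS (K : fieldType) (a0 a2 : {poly K}) (F : {polyxy K}) k :
  (riccati a0 a2 F)`_k.+1 =
  (F`_k)^`() + (a2 * F`_k) *+ k + (a0 * F`_k.+2) *+ k.+2.
Proof.
rewrite /riccati /vary /partial_y mulrDl -mulrA !coefD coefXM !coefCM coefXnM.
rewrite /= partial_xE !coef_deriv -addrA mulrnAr; congr (_ + (_ + _)).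
case: k => [|k]; first by rewrite mulr0 mulr0n.
by rewrite /= !subSS subn0 mulrnAr.
Qed.

Lemma riccatiM (K : fieldType) (a0 a2 : {poly K}) (p q : {polyxy K}) :
  riccati a0 a2 (p * q) = riccati a0 a2 p * q + p * riccati a0 a2 q.
Proof. by have [_ _] := riccati_derivation a0 a2. Qed.

Lemma riccatiC (K : fieldType) (a0 a2 v : {poly K}) :
  riccati a0 a2 v%:P = v^`()%:P * 'X.
Proof.
by rewrite /riccati partial_xC /partial_y derivC mulr0 addr0 mulrC.
Qed.

(** * Absence of Darboux polynomials *)

(** D raises the degree in y by at most one. *)
Lemma size_cofactor (K : fieldType) (a0 a2 : {poly K}) (F Q : {polyxy K}) :
  F != 0 -> riccati a0 a2 F = Q * F -> (size Q <= 2)%N.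
Proof.
move=> F_neq0 eqQ.
have [-> | Q_neq0] := eqVneq Q 0; first by rewrite size_poly0.
have : (size (Q * F)%R <= (size F).+1)%N.
  rewrite -eqQ; apply/leq_sizeP => -[|k] // le_F_k.
  rewrite coef_riccatiS [F`_k]nth_default // [F`_k.+2]nth_default.
    by rewrite deriv0 !mulr0 !mul0rn !addr0.
  by rewrite ltnW // ltnW.
rewrite size_mul //.
have : (0 < size F)%N by rewrite size_poly_gt0.
by case: (size F) => // n _; rewrite addnS /= -add2n leq_add2r.
Qed.

(** The coefficients of F, read from the top, satisfy the recurrence of
    [riccati_recurrence_neq0], which does not allow them to stop at the constant
    term. *)
Lemma riccati_no_darboux_divisor (K : fieldType)
    (charK : [pchar K] =i pred0) (c : K) (a2 : {poly K}) (F Q : {polyxy K}) :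
  c != 0 -> (1 < size a2)%N -> (1 < size F)%N ->
  riccati c%:P a2 F = Q * F -> False.
Proof.
move=> c_neq0 a2_gt1 F_gt1 eqQ.
have F_neq0 : F != 0 by rewrite -size_poly_gt0; lia.
have defQ : Q = (Q`_0)%:P + (Q`_1)%:P * 'X.
  apply/polyP=> -[|[|i]]; rewrite coefD coefMX !coefC /= ?addr0 ?add0r //.
  by rewrite nth_default // (leq_trans (size_cofactor F_neq0 eqQ)).
have eq0 : c%:P * F`_1 = Q`_0 * F`_0 by rewrite -(coef_riccati0 _ a2) eqQ coef0M.
have eqS k : (F`_k)^`() + (a2 * F`_k) *+ k + (c%:P * F`_k.+2) *+ k.+2 =
             Q`_0 * F`_k.+1 + Q`_1 * F`_k.
  rewrite -coef_riccatiS eqQ {1}defQ mulrDl coefD coefCM.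
  by rewrite -mulrA coefCM coefXM.
pose d := (size F).-1.
have defd : size F = d.+1 by rewrite /d; lia.
have F_gt_d k : (d < k)%N -> F`_k = 0.
  by move=> lt_dk; rewrite nth_default // defd.
have Fd_neq0 : F`_d != 0 by rewrite -[F`_d]/(lead_coef F) lead_coef_eq0.
(* The coefficient of y^(d+1) in D F = Q F. *)
have eqd : (F`_d)^`() = (Q`_1 - a2 *+ d) * F`_d.
  have := eqS d; rewrite (F_gt_d d.+1) // (F_gt_d d.+2) //.
  rewrite !mulr0 mul0rn addr0 add0r => eqd.
  by rewrite mulrBl -eqd mulrnAl addrK.
have Fd_const : size F`_d = 1%N.
  apply/eqP; rewrite eqn_leq size_poly_gt0 Fd_neq0 andbT.
  by apply: (dvd_deriv_const charK); rewrite eqd dvdp_mull.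
have Fd' : (F`_d)^`() = 0.
  have /size_poly1P[e _ ->] : size F`_d == 1%N by rewrite Fd_const.
  by rewrite derivC.
have defQ1 : Q`_1 = a2 *+ d.
  move/eqP: eqd; rewrite Fd' eq_sym mulf_eq0 (negPf Fd_neq0) orbF subr_eq0.
  by move/eqP.
pose h k := if (k <= d)%N then F`_(d - k) else 0.
suff : h d.+1 != 0 by rewrite /h ltnn eqxx.
apply: (@riccati_recurrence_neq0 _ charK a2 Q`_0 c) => //; rewrite ?/h.
- by rewrite /d; lia.
- by rewrite subn0.
- have [m defdm] : exists m, d = m.+1 by exists d.-1; rewrite /d; lia.
  have := eqS m; rewrite defQ1 (F_gt_d m.+2) ?defdm // subn1 subn0 /=.
  rewrite mulr0 mul0rn addr0 => eqm.
  by apply: (addIr ((a2 * F`_m) *+ m)); rewrite eqm; ring.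
move=> k lt_kd; rewrite lt_kd (ltnW lt_kd).
have [lt_Skd | ] := ltnP k.+1 d.
  have [m defdm] : exists m, d = (m + k.+2)%N by exists (d - k.+2)%N; lia.
  have := eqS m; rewrite defQ1.
  have -> : (d - k.+2 = m)%N by lia.
  have -> : (d - k.+1 = m.+1)%N by lia.
  have -> : (d - k = m.+2)%N by lia.
  rewrite [in a2 *+ d]defdm mulrnDr mulrDl !mulrnAl mul_polyC => eqm.
  apply: (addIr ((a2 * F`_m) *+ m + (c *: F`_m.+2) *+ m.+2)).
  by rewrite addrA eqm; ring.
(* For k = d - 1 the unknown h_(d+1) is 0 and the recurrence is the equation
   between the constant terms of D F and Q F. *)
move=> le_dSk; have -> : d = k.+1 by lia.
by rewrite deriv0 mulr0 mul0rn add0r subnn subSnn mulr1n -eq0 mul_polyC subrr.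
Qed.

(** If F = v F0 with F0 primitive, then u D F = Q F becomes
    u v D F0 = (Q v - u v' y) F0, because D v = v' y; Gauss's lemma then removes
    the factor u v. *)
Lemma riccati_no_darboux (K : fieldType)
    (charK : [pchar K] =i pred0) (c : K) (a2 : {poly K}) (F Q : {polyxy K})
    (u : {poly K}) :
  c != 0 -> (1 < size a2)%N -> (1 < size F)%N -> u != 0 ->
  u%:P * riccati c%:P a2 F = Q * F -> False.
Proof.
move=> c_neq0 a2_gt1 F_gt1 u_neq0 eqQ.
have F_neq0 : F != 0 by rewrite -size_poly_gt0; lia.
have [v [F0 [v_neq0 defF primF0]]] := primitive_part F_neq0.
have F0_gt1 : (1 < size F0)%N by move: F_gt1; rewrite defF mul_polyC size_scale.
have [Q' eqQ'] : exists Q', riccati c%:P a2 F0 = Q' * F0.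
  apply: (@gauss_primitive _ F0 _ (Q * v%:P - u%:P * v^`()%:P * 'X) (u * v)) => //.
    by rewrite mulf_neq0.
  have := eqQ; rewrite defF riccatiM riccatiC mulrDr polyCM => eqv.
  by rewrite mulrBl -[Q * _ * F0]mulrA -eqv; ring.
exact: riccati_no_darboux_divisor eqQ'.
Qed.

Lemma riccatiXn (K : fieldType) (a0 a2 : {poly K}) n :
  riccati a0 a2 'X^n = ((a2%:P * 'X ^+ 2 + a0%:P) * 'X^(n.-1)) *+ n.
Proof.
rewrite /riccati /vary /partial_y derivXn mulrnAr.
rewrite (_ : partial_x _ = 0) ?mulr0 ?add0r //.
apply/polyP=> i; rewrite partial_xE coefXn coef0.
by case: eqP; rewrite ?deriv0 // -polyC1 derivC.
Qed.

(** * Stable ideals *)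

(** D (y^(n+1)) = (n+1) (a2 y * y^(n+1) + c y^n), and (n+1) c is invertible. *)
Lemma stable_ideal_Xn (K : fieldType) (charK : [pchar K] =i pred0)
    (c : K) (a2 : {poly K}) (I : {polyxy K} -> Prop) (n : nat) :
  c != 0 -> is_ideal I -> is_stable (riccati c%:P a2) I ->
  I 'X^n -> I 1.
Proof.
move=> c_neq0 [_ ID IM] stI; elim: n => [|n IH] IXn.
  by rewrite expr0 in IXn.
apply: IH; pose e := c * n.+1%:R.
have e_neq0 : e != 0 by rewrite mulf_neq0 ?natr_neq0.
have -> : 'X^n = e^-1%:P%:P *
    (riccati c%:P a2 'X^(n.+1) + (- (a2%:P * 'X) *+ n.+1) * 'X^(n.+1)) :> {polyxy K}.
  have -> : riccati c%:P a2 'X^(n.+1) + (- (a2%:P * 'X) *+ n.+1) * 'X^(n.+1) =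
            e%:P%:P * 'X^n.
    by rewrite riccatiXn /= /e !polyCM !polyC_natr (exprS _ n); ring.
  by rewrite mulrA -!polyCM mulVf // mul1r.
by apply/IM/ID; [exact: stI | exact: IM].
Qed.

(** y D (p y^n) is p' y^(n+2) modulo p y^n: applying D costs powers of y but
    lowers the degree of p, until p is a nonzero constant.  The powers of y are
    then removed by [stable_ideal_Xn]. *)
Lemma stable_ideal_polyC (K : fieldType) (charK : [pchar K] =i pred0)
    (c : K) (a2 : {poly K}) (I : {polyxy K} -> Prop) :
  c != 0 -> is_ideal I -> is_stable (riccati c%:P a2) I ->
  forall (p : {poly K}) n, p != 0 -> I (p%:P * 'X^n) -> I 1.
Proof.
move=> c_neq0 idI stI p; have [_ ID IM] := idI.
have [k] := ubnP (size p); elim: k p => // k IH p le_pk n p_neq0 IpXn.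
have [p_le1 | p_gt1] := leqP (size p) 1.
  have /size_poly1P[e e_neq0 defp] : size p == 1%N.
    by rewrite eqn_leq p_le1 size_poly_gt0.
  apply: (stable_ideal_Xn (n := n) charK c_neq0 idI stI).
  have -> : 'X^n = e^-1%:P%:P * (p%:P * 'X^n) :> {polyxy K}.
    by rewrite defp mulrA -!polyCM mulVf // mul1r.
  exact: IM.
have p'_neq0 : p^`() != 0.
  apply: contraTneq p_gt1 => p'0; rewrite -leqNgt.
  by apply: (dvd_deriv_const charK); rewrite p'0 dvdp0.
apply: (IH p^`() _ n.+2) => //.
  by rewrite -ltnS; apply: leq_trans le_pk; rewrite ltnS lt_size_deriv.
have -> : p^`()%:P * 'X^(n.+2) = 'X * riccati c%:P a2 (p%:P * 'X^n) +
    (- (a2%:P * 'X ^+ 2 + c%:P%:P) *+ n) * (p%:P * 'X^n).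
  rewrite riccatiM riccatiC riccatiXn.
  by case: n {IpXn} => [|n] /=; rewrite ?mulr0n ?exprS; ring.
by apply: ID; apply: IM => //; apply: stI.
Qed.

Lemma exists_min_size (R : nzRingType) (P : {poly R} -> Prop) (p : {poly R}) :
  P p -> exists F, P F /\ forall G, P G -> (size F <= size G)%N.
Proof.
have [k] := ubnP (size p); elim: k p => // k IH p le_pk Pp.
have [[q [Pq lt_qp]] | min_p] := classic (exists q, P q /\ (size q < size p)%N).
  by apply: (IH q) => //; apply: leq_trans lt_qp _.
exists p; split=> // G PG; rewrite leqNgt; apply/negP => lt_Gp.
by case: min_p; exists G.
Qed.

(** The remainder of the pseudo-division of D F by F lies in I and is shorter than
    F, hence zero. *)
Lemma stable_ideal_darboux (K : fieldType) (a0 a2 : {poly K})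
    (I : {polyxy K} -> Prop) (F : {polyxy K}) :
  is_ideal I -> is_stable (riccati a0 a2) I ->
  I F -> F != 0 -> (forall G, I G /\ G != 0 -> (size F <= size G)%N) ->
  exists u Q, u != 0 /\ u%:P * riccati a0 a2 F = Q * F.
Proof.
move=> [_ ID IM] stI IF F_neq0 minF; set DF := riccati a0 a2 F.
have eqDF := Pdiv.Idomain.divp_eq DF F.
exists (lead_coef F ^+ scalp DF F), (DF %/ F).
rewrite expf_neq0 ?lead_coef_eq0 // mul_polyC eqDF; split=> //.
suff -> : DF %% F = 0 by rewrite addr0.
apply/eqP/negPn/negP => R_neq0.
have : (size (DF %% F)%R < size F)%N by rewrite ltn_modp.
rewrite ltnNge => /negP; apply; apply: minF; split=> //.
have -> : DF %% F = (lead_coef F ^+ scalp DF F)%:P * DF + (- (DF %/ F)) * F.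
  by rewrite mul_polyC eqDF mulNr addrC addKr.
by apply: ID; apply: IM => //; apply: stI.
Qed.

Lemma riccati_simple (K : fieldType) (charK : [pchar K] =i pred0)
    (c : K) (a2 : {poly K}) :
  c != 0 -> (1 < size a2)%N -> is_simple (riccati c%:P a2).
Proof.
move=> c_neq0 a2_gt1; split=> [|I idI stI]; first exact: riccati_derivation.
have [I0 ID IM] := idI.
have [[p Ip] | I_0] := classic (exists p, I p /\ p != 0); last first.
  left=> p; split=> [Ip | -> //]; apply/eqP/negPn/negP => p_neq0.
  by apply: I_0; exists p.
right=> q; rewrite -[q]mulr1; apply: IM.
have [F [[IF F_neq0] minF]] := exists_min_size (P := fun p => I p /\ p != 0) Ip.
have [F_le1 | F_gt1] := leqP (size F) 1.
  have /size_poly1P[f f_neq0 defF] : size F == 1%N.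
    by rewrite eqn_leq F_le1 size_poly_gt0.
  apply: (stable_ideal_polyC charK c_neq0 idI stI (p := f) (n := 0)) => //.
  by rewrite expr0 mulr1 -defF.
have [u [Q [u_neq0 eqQ]]] := stable_ideal_darboux idI stI IF F_neq0 minF.
by case: (riccati_no_darboux charK c_neq0 a2_gt1 F_gt1 u_neq0 eqQ).
Qed.

(** The multiples of a Darboux polynomial form a stable ideal. *)
Lemma simple_darboux (K : fieldType) (D : {polyxy K} -> {polyxy K})
    (G Q : {polyxy K}) :
  is_simple D -> D G = Q * G -> G != 0 -> (size G <= 1)%N.
Proof.
move=> [[_ _ DM] simD] eqG G_neq0.
have [|p [q ->]||/(_ 1)[q eq1]] := simD (fun p => exists q, p = q * G).
- split=> [|_ _ [p ->] [q ->]|r _ [q ->]]; first by exists 0; rewrite mul0r.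
    by exists (p + q); rewrite mulrDl.
  by exists (r * q); rewrite mulrA.
- by exists (D q + q * Q); rewrite DM eqG mulrDl mulrA.
- move/(_ G) => [GG _]; have /eqP := GG (ex_intro _ 1 (esym (mul1r G))).
  by rewrite (negPf G_neq0).
have q_neq0 : q != 0.
  by apply: contra_eq_neq eq1 => ->; rewrite mul0r oner_neq0.
have := congr1 (fun p : {polyxy K} => size p) eq1.
rewrite size_poly1 size_mul //; rewrite -size_poly_gt0 in q_neq0.
case: (size q) q_neq0 => // n _; rewrite addSn /= => size1.
by rewrite (leq_trans (leq_addl n _)) -?size1.
Qed.

(** The ideal is (a0, y): membership is divisibility of the constant term in y
    by a0, and the constant term of D p is a0 times a coefficient of p. *)
Lemma simple_riccati_a0 (K : fieldType) (a0 a2 : {poly K}) :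
  is_simple (riccati a0 a2) -> size a0 = 1%N.
Proof.
move=> [_ simD].
have [|p|I_0|/(_ 1)] := simD (fun p => a0 %| p`_0).
- split=> [|p q|r p]; first by rewrite coef0 dvdp0.
    by rewrite coefD; exact: dvdp_add.
  by rewrite coef0M; exact: dvdp_mull.
- by rewrite coef_riccati0 dvdp_mulr.
- have : 'X = 0 :> {polyxy K} by apply/I_0; rewrite coefX dvdp0.
  by move/eqP; rewrite polyX_eq0.
by rewrite coefC dvdp1 => /eqP.
Qed.

(** For constant a2 = e there is a first integral y^2 - 2 c x if e = 0, and the
    Darboux polynomial e y^2 + c with cofactor 2 e y otherwise. *)
Lemma simple_riccati_a2 (K : fieldType) (c : K) (a2 : {poly K}) :
  is_simple (riccati c%:P a2) -> (1 < size a2)%N.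
Proof.
move=> simD; rewrite ltnNge; apply/negP => /size1_polyC.
move: a2`_0 => e def2; rewrite {}def2 in simD.
have [DD DZ _] := simD.1.
have Dy2 : riccati c%:P e%:P (vary K ^+ 2) =
    (e%:P%:P * vary K ^+ 2 + c%:P%:P) * vary K *+ 2.
  by rewrite expr2 riccatiM riccati_y; ring.
have [e0 | e_neq0] := eqVneq e 0.
  pose G : {polyxy K} := vary K ^+ 2 + (- (c *+ 2))%:P%:P * varx K.
  have size_G : size G = 3.
    rewrite size_polyDl size_polyXn // /varx -polyCM.
    by apply: leq_ltn_trans (size_polyC_leq1 _) _.
  have : (size G <= 1)%N.
    apply: (simple_darboux (Q := 0) simD); last by rewrite -size_poly_gt0 size_G.
    rewrite DD DZ Dy2 riccati_x e0 mul0r !polyCN !polyCMn.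
    ring.
  by rewrite size_G.
pose G : {polyxy K} := e%:P%:P * vary K ^+ 2 + c%:P%:P.
have size_G : size G = 3.
  have size_X2 : size (e%:P%:P * vary K ^+ 2) = 3.
    by rewrite mul_polyC size_scale ?polyC_eq0 // size_polyXn.
  rewrite size_polyDl size_X2 //.
  by apply: leq_ltn_trans (size_polyC_leq1 _) _.
have : (size G <= 1)%N.
  apply: (simple_darboux (Q := e%:P%:P * vary K *+ 2) simD).
    by rewrite DD DZ Dy2 riccatiC derivC /G; ring.
  by rewrite -size_poly_gt0 size_G.
by rewrite size_G.
Qed.

Theorem theorem2p1 (K : fieldType) (charK : [pchar K] =i pred0)
    (a0 a2 : {poly K}) :
  is_simple (riccati a0 a2) <->
  (exists2 c : K, c != 0 & a0 = c%:P) /\ (1 < size a2)%N.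
Proof.
split=> [simD | [[c c_neq0 ->] a2_gt1]]; last exact: riccati_simple.
have /eqP/size_poly1P[c c_neq0 def0] := simple_riccati_a0 simD.
by split; [exists c | apply: (@simple_riccati_a2 _ c); rewrite -def0].
Qed.
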